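(* Under the setting of the previous statement (constants $\sigma_w^2>0$, $\gamma>0$, $P_j^{\max}>0$, $0<\lambda<\tilde\lambda$; $P_{FA}$ and $P_{MD}$ as functions of $\tau_{dt}>0$), let the detection error probability be $P_e(\tau_{dt})=P_{FA}(\tau_{dt})+P_{MD}(\tau_{dt})$. Define $$\Delta=\frac{e^{\gamma P_j^{\max}/\lambda}-1}{e^{\gamma P_j^{\max}/\tilde\lambda}-1}.$$ Then the threshold $$\tau_{dt}^*=\frac{\tilde\lambda\lambda}{\tilde\lambda-\lambda}\ln\Delta+\sigma_w^2$$ satisfies $\tau_{dt}^*\in[\sigma_w^2+\gamma P_j^{\max},\infty)$ and minimizes $P_e$ over all $\tau_{dt}>0$, and the minimum value is $$P_e^*=P_e(\tau_{dt}^* )=1-\frac{\tilde\lambda\big(e^{\gamma P_j^{\max}/\tilde\lambda}-1\big)\Delta^{\frac{\lambda}{\lambda-\tilde\lambda}}-\lambda\big(e^{\gamma P_j^{\max}/\lambda}-1\big)\Delta^{\frac{\tilde\lambda}{\lambda-\tilde\lambda}}}{\gamma P_j^{\max}}.$$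
   Context: Setting: $P_j$ is uniform on $[0,P_j^{\max}]$; under $\mathcal H_0$, $\overline P_w=X_0+\gamma P_j+\sigma_w^2$ with $X_0$ exponential of mean $\lambda$ independent of $P_j$; under $\mathcal H_1$, $\overline P_w=X_1+\gamma P_j+\sigma_w^2$ with $X_1$ exponential of mean $\tilde\lambda$ independent of $P_j$. $P_{FA}(\tau_{dt})=\Pr(\overline P_w>\tau_{dt}\mid\mathcal H_0)$ and $P_{MD}(\tau_{dt})=\Pr(\overline P_w<\tau_{dt}\mid\mathcal H_1)$. *)

(* Defs.v *)
From HB Require Import structures.
From mathcomp Require Import all_boot all_order all_algebra.
From mathcomp Require Import all_classical all_reals all_analysis.
Set Implicit Arguments. Unset Strict Implicit. Unset Printing Implicit Defensive.
Import Order.TTheory GRing.Theory Num.Theory.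
Local Open Scope classical_set_scope.
Local Open Scope ring_scope.

Definition indep2 {d} {T : measurableType d} {R : realType}
  (P : probability T R) (X Y : T -> R) : Prop :=
  forall A B : set R, measurable A -> measurable B ->
    P (X @^-1` A `&` Y @^-1` B) = (P (X @^-1` A) * P (Y @^-1` B))%E.

Definition has_law {d} {T : measurableType d} {R : realType}
  (P : probability T R) (X : {RV P >-> R}) (mu : set R -> \bar R) : Prop :=
  forall A : set R, measurable A -> distribution P X A = mu A.

Definition recv_power {T : Type} {R : realType} (X Pj : T -> R) (gamma sigma2 : R)
  : T -> R := fun w => X w + gamma * Pj w + sigma2.

(* P_FA(tau) = Pr(Pw > tau | H0) *)
Definition PFA {d} {T : measurableType d} {R : realType}
  (P : probability T R) (X Pj : T -> R) (gamma sigma2 tau : R) : R :=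
  fine (P [set w | tau < recv_power X Pj gamma sigma2 w]).

(* P_MD(tau) = Pr(Pw < tau | H1) *)
Definition PMD {d} {T : measurableType d} {R : realType}
  (P : probability T R) (X Pj : T -> R) (gamma sigma2 tau : R) : R :=
  fine (P [set w | recv_power X Pj gamma sigma2 w < tau]).

(* Main.v *)
(* With [a = gamma * Pmax] and [s = tau - sigma2], conditioning on the uniform
   variable gives the tail of [X + gamma * Pj] in closed form
   ([exp_unif_tail]), and [Pe = 1 - gap s] where [gap] is the difference of the
   tails for the means [lamt] and [lam]. The gap vanishes for [s <= 0] and
   increases on [0, a]; for [s >= a] it is a combination of two exponentials
   whose derivative vanishes exactly at [s = tau_star - sigma2]. All the
   monotonicity statements reduce to [1 + x <= expR x]. *)
Require Import Defs.
From HB Require Import structures.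
From mathcomp Require Import all_boot all_order all_algebra.
From mathcomp Require Import all_classical all_reals all_analysis.
From mathcomp Require Import measurable_realfun ring lra.
Import Order.TTheory GRing.Theory Num.Theory.
Import numFieldNormedType.Exports.
Local Open Scope classical_set_scope.
Local Open Scope ring_scope.

(* [P(X + U > s)] for independent [X] exponential of mean [m] and [U] uniform
   on [0, a]. *)
Definition exp_unif_tail {R : realType} (a m s : R) : R :=
  if s <= 0 then 1
  else if s <= a then 1 - (s - m * (1 - expR (- s / m))) / a
  else m * (expR (a / m) - 1) * expR (- s / m) / a.

(** * Real analysis of the tail formula and of the gap between two means *)

Section exp_unif_tail_gap.
Context {R : realType}.
Implicit Types a l t h m s : R.

(* [1 + x <= expR x] at [x = - (t - l) h / (l t)] and at [x = h / t]. *)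
Lemma mean_expR_gap_le l t h : 0 < l -> l <= t ->
  t * expR (- h / t) - l * expR (- h / l) <= t - l.
Proof.
move=> l0 lt; have t0 : 0 < t by exact: lt_le_trans lt.
set u := - h / t.
have -> : - h / l = u + (t - l) / l * u.
  by rewrite /u; field; rewrite !gt_eqF.
rewrite expRD.
have e0 : 0 < expR u := expR_gt0 u.
have e1 : expR u * (1 - u) <= 1.
  by rewrite -[leRHS](expRxMexpNx_1 u) ler_pM2l// expR_ge1Dx.
have e2 : l * (expR u * expR ((t - l) / l * u)) >= expR u * (l + (t - l) * u).
  have -> : l + (t - l) * u = l * (1 + (t - l) / l * u).
    by field; rewrite gt_eqF.
  by rewrite mulrCA ler_pM2l// ler_pM2l// expR_ge1Dx.
have e3 : 0 <= (t - l) * (1 - expR u * (1 - u)) by rewrite mulr_ge0// subr_ge0.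
lra.
Qed.

(** With [A], [C] the exponentials at [s] and [B], [D] those at [h] (means [t], [l]), the increment
    is [A * (t - t * B) - C * (l - l * D)]. It equals [A * ((t - t * B) - (l - l * D)) + (A - C) *
    (l * (1 - D))], and both terms are nonnegative. *)
Lemma mean_exp_cdf_gap_nondecreasing l t s h : 0 < l -> l <= t -> 0 <= s -> 0 <= h ->
  t * (1 - expR (- s / t)) - l * (1 - expR (- s / l)) <=
  t * (1 - expR (- (s + h) / t)) - l * (1 - expR (- (s + h) / l)).
Proof.
move=> l0 lt s0 h0; have t0 : 0 < t by exact: lt_le_trans lt.
rewrite !opprD !mulrDl !expRD.
have gap := mean_expR_gap_le l t h l0 lt.
have : expR (- s / l) <= expR (- s / t).
  by rewrite ler_expR !mulNr lerN2 ler_wpM2l// lef_pV2.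
have h1 : 0 <= l * (1 - expR (- h / l)).
  by rewrite mulr_ge0 ?subr_ge0 ?(ltW l0)// -expR0 ler_expR mulNr oppr_le0 divr_ge0// ltW.
move: (expR_gt0 (- s / t)) gap h1.
move: (expR (- s / t)) (expR (- s / l)) (expR (- h / t)) (expR (- h / l)).
move=> A C B D A0 gap h1 CA.
have : 0 <= (A - C) * (l * (1 - D)) by rewrite mulr_ge0// subr_ge0.
have : 0 <= A * ((t - t * B) - (l - l * D)) by rewrite mulr_ge0// ?(ltW A0)//; lra.
lra.
Qed.

Lemma exp_unif_tail_mid a m s : 0 < a -> 0 <= s -> s <= a ->
  exp_unif_tail a m s = 1 - (s - m * (1 - expR (- s / m))) / a.
Proof.
move=> a0 s0 sa; rewrite /exp_unif_tail sa; case: ifPn => // sle0.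
have -> : s = 0 by apply/eqP; rewrite eq_le sle0.
by rewrite oppr0 mul0r expR0 subrr mulr0 subrr mul0r subr0.
Qed.

(** At [s = a] the definition takes its middle branch, but the two formulas agree there, so the last
    one is valid on the closed half-line. *)
Lemma exp_unif_tail_ge a m s : 0 < a -> a <= s ->
  exp_unif_tail a m s = m * (expR (a / m) - 1) * expR (- s / m) / a.
Proof.
move=> a0; rewrite le_eqVlt => /predU1P[<-|sa].
  rewrite exp_unif_tail_mid ?(ltW a0)// mulNr expRN; field.
  by rewrite !gt_eqF ?expR_gt0.
by rewrite /exp_unif_tail !leNgt (lt_trans a0)//= sa.
Qed.

(** * Location and optimality of the threshold *)

Section optimal_threshold.
Variables a l t : R.
Hypotheses (a0 : 0 < a) (l0 : 0 < l) (lt : l < t).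
Let t0 : 0 < t. Proof. exact: lt_trans lt. Qed.
Let tl0 : 0 < t - l. Proof. by rewrite subr_gt0. Qed.
Let lt_nz : l - t != 0. Proof. by rewrite lt_eqF// subr_lt0. Qed.
Let gap s := exp_unif_tail a t s - exp_unif_tail a l s.
Let Delta := (expR (a / l) - 1) / (expR (a / t) - 1).
Let opt := t * l / (t - l) * ln Delta.

Let expm1_gt0 m : 0 < m -> 0 < expR (a / m) - 1.
Proof. by move=> m0; rewrite subr_gt0 expR_gt1 divr_gt0. Qed.

Let Delta_gt0 : 0 < Delta.
Proof. by rewrite divr_gt0 ?expm1_gt0. Qed.

(** After exponentiation the claim is [expR (a / l - a / t) <= Delta]. Clearing the denominator of
    [Delta] leaves [1 <= expR (a / l - a / t)], which holds because [l < t]. *)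
Lemma optimal_threshold_ge : a <= opt.
Proof.
suff : a * (t - l) / (t * l) <= ln Delta.
  rewrite /opt; move: (ln Delta) => L.
  rewrite -(ler_pM2l (x := t * l / (t - l))) ?divr_gt0 ?mulr_gt0//.
  by apply: le_trans; rewrite le_eqVlt; apply/orP; left; apply/eqP; field;
    rewrite !gt_eqF.
rewrite -ler_expR lnK ?posrE// ler_pdivlMr ?expm1_gt0//.
have -> : a * (t - l) / (t * l) = a / l - a / t.
  by field; rewrite !gt_eqF.
rewrite mulrBr -expRD subrK mulr1 lerD2l lerN2 -expR0 ler_expR subr_ge0.
by rewrite ler_pM2l// lef_pV2// ltW.
Qed.

Let expR_opt_l : expR (- opt / l) = Delta `^ (t / (l - t)).
Proof.
rewrite /powR gt_eqF//; congr expR; rewrite /opt; field.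
by rewrite lt_nz !gt_eqF.
Qed.

Let expR_opt_t : expR (- opt / t) = Delta `^ (l / (l - t)).
Proof.
rewrite /powR gt_eqF//; congr expR; rewrite /opt; field.
by rewrite lt_nz !gt_eqF.
Qed.

Lemma gap_optimal_threshold : gap opt =
  (t * (expR (a / t) - 1) * Delta `^ (l / (l - t))
   - l * (expR (a / l) - 1) * Delta `^ (t / (l - t))) / a.
Proof.
rewrite /gap !exp_unif_tail_ge ?optimal_threshold_ge//.
by rewrite expR_opt_l expR_opt_t mulrBl.
Qed.

(* First-order optimality: the two densities agree at [opt]. *)
Let balance : (expR (a / l) - 1) * expR (- opt / l) =
              (expR (a / t) - 1) * expR (- opt / t).
Proof.
have -> : - opt / l = - opt / t - ln Delta.
  by rewrite /opt; field; rewrite !gt_eqF.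
rewrite expRD [expR (- ln _)]expRN lnK ?posrE// /Delta; field.
by rewrite !gt_eqF ?expm1_gt0.
Qed.

(** Put [h = s - opt], of either sign, and let [K] be the common value in [balance]. Then [gap s] is
    [K / a] times [t * expR (- h / t) - l * expR (- h / l)], which [mean_expR_gap_le] bounds by its
    value [t - l] at [h = 0]. *)
Let gap_le_ge s : a <= s -> gap s <= gap opt.
Proof.
move=> sa; rewrite /gap !exp_unif_tail_ge ?optimal_threshold_ge//.
rewrite -!mulrBl ler_pM2r ?invr_gt0//.
have split m : - s / m = - opt / m + - (s - opt) / m.
  by rewrite -mulrDl; congr (_ / _); ring.
rewrite !split !expRD.
have K0 : 0 <= (expR (a / t) - 1) * expR (- opt / t).
  by rewrite mulr_ge0 ?expR_ge0// ltW// expm1_gt0.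
have := ler_wpM2l K0 (mean_expR_gap_le l t (s - opt) l0 (ltW lt)).
move: balance; move: (expR _) (expR _) (expR _) (expR _) (expR _) (expR _).
move=> x1 x2 x3 x4 x5 x6 bal h.
(* Here [x6], [x5], [x1] are the exponentials of [a / l], [- opt / l], [- (s - opt) / l], and [x4],
   [x3], [x2] their analogues for [t]. *)
have e1 : l * (x6 - 1) * (x5 * x1) = (x4 - 1) * x3 * l * x1.
  by rewrite -bal; ring.
have e2 : l * (x6 - 1) * x5 = (x4 - 1) * x3 * l by rewrite -bal; ring.
rewrite e1 e2; lra.
Qed.

Lemma gap_le_optimal_threshold s : gap s <= gap opt.
Proof.
have [/gap_le_ge//|sa] := leP a s.
(* Below [a], the value [gap a] serves as intermediate bound. *)
apply: le_trans (gap_le_ge a (lexx _)).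
(* For [s < 0] both tails equal 1, as they do at 0. *)
wlog s0 : s sa / 0 <= s => [hw|].
  have [/hw|s0] := leP 0 s; first exact.
  have -> : gap s = gap 0 by rewrite /gap /exp_unif_tail lexx (ltW s0).
  exact: hw.
have a_ge0 := ltW a0; have sa' := ltW sa.
rewrite /gap !exp_unif_tail_mid//.
have := mean_exp_cdf_gap_nondecreasing l t s (a - s) l0 (ltW lt) s0.
rewrite subrKC subr_ge0 => /(_ sa') h.
rewrite -subr_ge0.
set x := (X in 0 <= X).
(* The linear terms of the middle branch do not depend on the mean and cancel in the gap. *)
have -> : x = ((t * (1 - expR (- a / t)) - l * (1 - expR (- a / l))) -
  (t * (1 - expR (- s / t)) - l * (1 - expR (- s / l)))) / a.
  by rewrite /x; field; rewrite gt_eqF.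
by rewrite divr_ge0 ?subr_ge0// ltW.
Qed.

End optimal_threshold.
End exp_unif_tail_gap.

(** Independence makes the joint law agree with the product measure on rectangles, hence everywhere
    by uniqueness. The variant [\x^] of the product is the one defined by integrating over the
    second coordinate, which is conditioning on [Y]. *)
Lemma indep2_probE {d} {T : measurableType d} {R : realType}
    (P : probability T R) (X Y : {RV P >-> R}) (A : set (R * R)) :
  indep2 P X Y -> measurable A ->
  P [set w | A (X w, Y w)] =
  (\int[distribution P Y]_y distribution P X (ysection A y))%E.
Proof.
move=> XY mA.
have mXY : measurable_fun setT (fun w => (X w, Y w)).
  exact: measurable_fun_pair.
pose XYT := mfun_Sub (mem_set mXY) : {RV P >-> (R * R)%type}.
have E1 : (distribution P X \x distribution P Y)%E A = distribution P XYT A.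
  by apply: product_measure_unique => // B C mB mC; exact: XY.
have E2 : (distribution P X \x distribution P Y)%E A =
          (distribution P X \x^ distribution P Y)%E A.
  apply: product_measure_unique => // B C mB mC; exact: product_measure2E.
by rewrite -[RHS]E2 E1.
Qed.

(** * Exponential integrals by the fundamental theorem of calculus *)

Section exp_integrals.
Context {R : realType}.
Notation mu := (@lebesgue_measure R).
Implicit Types m g u v s t : R.

(** The boolean covers open and closed half-lines: [PFA] concerns an open one, [PMD] the complement
    of a closed one. The [Num.max] appears because the density vanishes on negative reals. *)
Lemma exponential_prob_tail m t (b : bool) : 0 < m ->
  exponential_prob m^-1 [set` Interval (BSide b t) +oo%O] =
  (expR (- Num.max t 0 / m))%:E.
Proof.
move=> m0; have m1 : 0 < m^-1 by rewrite invr_gt0.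
have -> : exponential_prob m^-1 [set` Interval (BSide b t) +oo%O] =
          exponential_prob m^-1 `[t, +oo[.
  case: b => //; apply: integral_itv_obnd_cbnd.
  apply/measurable_EFinP/measurable_funTS; exact: measurable_exponential_pdf.
have -> : exponential_prob m^-1 `[t, +oo[ =
          exponential_prob m^-1 `[Num.max t 0, +oo[.
  have pdfE V : exponential_prob m^-1 V =
      (\int[mu]_(x in V `&` `[0%R, +oo[) (m^-1 * expR (- m^-1 * x))%:E)%E.
    rewrite integral_mkcondr; apply: eq_integral => x _.
    by rewrite /exponential_pdf !patchE; case: ifP.
  rewrite !pdfE.
  congr (integral _ _ _); apply/seteqP; split => x /=;
    rewrite !in_itv/= !andbT ge_max.
    by move=> [-> ->].
  by move=> [/andP[-> ->]].
set v := Num.max t 0; have v0 : 0 <= v by rewrite le_max lexx orbT.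
have cexp : continuous (fun x : R^o => expR (- m^-1 * x)).
  move=> z; apply: continuous_comp; last exact: continuous_expR.
  by apply: continuousM => //; exact: cst_continuous.
rewrite /exponential_prob (@ge0_continuous_FTC2y _ _ (fun x => - expR (- m^-1 * x)) _ 0).
- by rewrite sub0e EFinN oppeK mulrC mulrN mulNr.
- by move=> x _; apply: exponential_pdf_ge0; exact: ltW.
- apply: (@continuous_subspaceW R^o _ _ [set` `[0, +oo[%R]).
    by move=> x /=; rewrite !in_itv/= !andbT; exact: le_trans.
  exact: within_continuous_exponential_pdf.
- rewrite -oppr0; apply: cvgN.
  rewrite (_ : (fun x => expR (- m^-1 * x)) =
               (fun z => expR (- z)) \o (fun z => m^-1 * z)); last first.
    by apply: eq_fun => x; rewrite mulNr.
  apply: (@cvg_comp _ _ _ _ _ _ (pinfty_nbhs R)); last exact: cvgr_expR.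
  exact: gt0_cvgMry.
- by move=> x _; exact: ex_derive.
- by apply: cvgN; apply/cvg_at_right_filter; exact: cexp.
- move=> x; rewrite in_itv/= andbT => vx.
  by apply: derive1_exponential_pdf; rewrite in_itv/= andbT (le_lt_trans v0).
Qed.

Lemma integral_itv_expR_affine m g s u v : 0 < m -> 0 < g -> u <= v ->
  (\int[mu]_(y in `[u, v]) (expR (- (s - g * y) / m))%:E =
   (m / g * (expR (- (s - g * v) / m) - expR (- (s - g * u) / m)))%:E)%E.
Proof.
move=> m0 g0; rewrite le_eqVlt => /predU1P[->|uv].
  by rewrite set_itv1 integral_set1 subrr mulr0.
have D (y : R) : is_derive y 1 (fun y : R => m / g * expR (- (s - g * y) / m))
                   (expR (- (s - g * y) / m)).
  apply: is_derive_eq; rewrite /GRing.scale/=; field; by rewrite !gt_eqF.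
(* Used with [c = 1] for the integrand and [c = m / g] for the antiderivative. *)
have C (c : R) : continuous (fun y : R => c * expR (- (s - g * y) / m)).
  by move=> y; apply: differentiable_continuous; apply/derivable1_diffP; exact: ex_derive.
rewrite (@continuous_FTC2 _ _ (fun y => m / g * expR (- (s - g * y) / m)))//.
- by rewrite -EFinB mulrBr.
- apply: continuous_subspaceT => y.
  by have := C 1 y; under eq_fun do rewrite mul1r.
- split.
  + by move=> y _; exact: ex_derive.
  + by apply/cvg_at_right_filter; exact: C.
  + by apply/cvg_at_left_filter; exact: C.
- by move=> y _; rewrite derive1E derive_val.
Qed.

End exp_integrals.

(** * Law of the received power *)

Section received_power.
Context {R : realType}.
Notation mu := (@lebesgue_measure R).

Lemma measurable_exponential_tail (m g s : R) :
  measurable_fun setT (fun y : R => (expR (- Num.max (s - g * y) 0 / m))%:E).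
Proof.
apply/measurable_EFinP; apply: measurableT_comp => //.
apply: measurable_funM => //; apply: measurableT_comp => //.
apply: measurable_maxr => //; exact: measurable_funB.
Qed.

(** The integrand is exponential up to [y = s / g] ([decay]) and constantly 1 beyond ([flat]). This
    crossover lies left of, right of or inside the interval, which yields the three branches of
    [exp_unif_tail]. *)
Lemma integral_itv_exponential_tail (m g p s : R) : 0 < m -> 0 < g -> 0 < p ->
  (\int[mu]_(y in `[0%R, p]) (expR (- Num.max (s - g * y) 0 / m))%:E =
   (p * exp_unif_tail (g * p) m s)%:E)%E.
Proof.
move=> m0 g0 p0; set f := fun y => (expR (- Num.max (s - g * y) 0 / m))%:E.
have mf : measurable_fun setT f by exact: measurable_exponential_tail.
have flat (u v : R) : u <= v -> s <= g * u ->
    (\int[mu]_(y in `[u, v]) f y = (v - u)%:E)%E.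
  move=> uv su; rewrite (eq_integral (cst 1%E)).
    rewrite integral_cst//= mul1e lebesgue_measure_itv/= lte_fin.
    by case: ltgtP uv => // ->; rewrite subrr.
  move=> y; rewrite inE/= in_itv/= => /andP[uy _]; rewrite /f.
  have -> : Num.max (s - g * y) 0 = 0.
    by apply/max_idPr; rewrite subr_le0 (le_trans su)// ler_pM2l.
  by rewrite oppr0 mul0r expR0.
have decay (u v : R) : u <= v -> g * v <= s ->
    (\int[mu]_(y in `[u, v]) f y =
     (m / g * (expR (- (s - g * v) / m) - expR (- (s - g * u) / m)))%:E)%E.
  move=> uv vs; rewrite -integral_itv_expR_affine//; apply: eq_integral => y.
  rewrite inE/= in_itv/= => /andP[_ yv]; rewrite /f.
  have -> // : Num.max (s - g * y) 0 = s - g * y.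
  by apply/max_idPl; rewrite subr_ge0 (le_trans _ vs)// ler_pM2l.
have gp0 : 0 < g * p by rewrite mulr_gt0.
have [s0|s0] := leP s 0.
  by rewrite flat ?mulr0// ?ltW// subr0 /exp_unif_tail s0 mulr1.
have [sp|sp] := leP (g * p) s.
  rewrite decay// ?ltW// exp_unif_tail_ge// mulr0 subr0 opprB mulrBl expRD mulNr.
  by congr EFin; field; rewrite !gt_eqF.
pose c := s / g.
have c0 : 0 <= c by rewrite divr_ge0 ?ltW.
have cp : c <= p by rewrite ler_pdivrMr// mulrC ltW.
have gc : g * c = s by rewrite /c mulrC divfK// gt_eqF.
have -> : `[0, p]%classic = `[0, c]%classic `|` `]c, p]%classic :> set R.
  by rewrite -itv_bndbnd_setU// bnd_simp.
rewrite ge0_integral_setU//; last 2 first.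
- exact: measurable_funTS.
- by apply/disj_setPS => y /=; rewrite !in_itv/= => -[/andP[_ yc] /andP[]]; lra.
rewrite integral_itv_obnd_cbnd; last exact: measurable_funTS.
rewrite decay ?gc// flat ?gc// exp_unif_tail_mid ?ltW//.
rewrite -EFinD; congr EFin.
rewrite mulr0 subr0 subrr oppr0 mul0r expR0 /c; field.
by rewrite !gt_eqF.
Qed.

(* [distribution P Y] and [uniform_prob ab] live on two copies of the Borel
   sigma-algebra of [R] with different displays; the identity map between them
   transports the integral. *)
Lemma integral_uniform_distribution {d} {T : measurableType d}
    (P : probability T R) (Y : {RV P >-> R}) (a b : R) (ab : a < b)
    (f : R -> \bar R) :
  has_law Y (uniform_prob ab) -> measurable_fun setT f ->
  (forall y, 0 <= f y)%E ->
  (\int[distribution P Y]_y f y =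
   (b - a)^-1%:E * \int[mu]_(y in `[a, b]) f y)%E.
Proof.
move=> lawY mf f0; rewrite -(integral_uniform ab mf)//.
pose idTR : measurableTypeR R -> R := idfun.
have mid : measurable_fun setT idTR by exact: (@measurable_id _ _ setT).
pose idRV := mfun_Sub (mem_set mid) : {RV uniform_prob ab >-> R}.
rewrite (eq_measure_integral (distribution (uniform_prob ab) idRV)).
  by rewrite ge0_integral_distribution.
by move=> B mB _; exact: lawY.
Qed.

Lemma recv_power_tail {d} {T : measurableType d} (P : probability T R)
    (X Y : {RV P >-> R}) (m g p sigma2 tau : R) (p0 : 0 < p) (b : bool) :
  0 < m -> 0 < g ->
  has_law X (exponential_prob m^-1) -> has_law Y (uniform_prob p0) ->
  indep2 P X Y ->
  P [set w | recv_power X Y g sigma2 w \in Interval (BSide b tau) +oo%O] =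
  (exp_unif_tail (g * p) m (tau - sigma2))%:E.
Proof.
move=> m0 g0 lawX lawY XY.
pose A := [set z : R * R | z.1 + g * z.2 + sigma2 \in Interval (BSide b tau) +oo%O].
have mA : measurable A.
  have mf : measurable_fun setT (fun z : R * R => z.1 + g * z.2 + sigma2).
    apply: measurable_funD => //; apply: measurable_funD => //.
    exact: measurable_funM.
  have := mf measurableT _ (measurable_itv (Interval (BSide b tau) +oo%O)).
  by rewrite setTI.
rewrite (indep2_probE P X Y A XY mA).
rewrite (eq_integral (fun y => (expR (- Num.max (tau - sigma2 - g * y) 0 / m))%:E)).
  rewrite (integral_uniform_distribution P Y _ _ p0)//; last first.
    exact: measurable_exponential_tail.
  rewrite integral_itv_exponential_tail// subr0 -EFinM mulrA mulVf ?mul1r//.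
  by rewrite gt_eqF.
move=> y _; rewrite lawX; last exact: measurable_ysection.
rewrite -(exponential_prob_tail _ _ b)//; congr exponential_prob.
(* The section of [A] at [y] is the half-line starting at [tau - sigma2 - g * y]. *)
apply/seteqP; split => x; rewrite /ysection/= inE /A/= !in_itv/= !andbT;
  by case: (b) => /=; lra.
Qed.

End received_power.

(** * Closed forms of the two error probabilities *)

Section detection_errors.
Context {R : realType} {d : measure_display} {T : measurableType d}.
Variables (P : probability T R) (X Y : {RV P >-> R}).
Variables (m g p sigma2 : R) (p0 : 0 < p).
Hypotheses (m0 : 0 < m) (g0 : 0 < g).
Hypotheses (lawX : has_law X (exponential_prob m^-1)).
Hypotheses (lawY : has_law Y (uniform_prob p0)) (XY : indep2 P X Y).

Lemma PFA_exp_unif tau :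
  PFA P X Y g sigma2 tau = exp_unif_tail (g * p) m (tau - sigma2).
Proof.
rewrite /PFA -[RHS]/(fine _%:E) -(recv_power_tail P X Y _ _ _ _ _ p0 false)//.
by congr (fine (P _)); apply/seteqP; split => w /=; rewrite in_itv/= andbT.
Qed.

Lemma PMD_exp_unif tau :
  PMD P X Y g sigma2 tau = 1 - exp_unif_tail (g * p) m (tau - sigma2).
Proof.
have mf : measurable_fun setT (recv_power X Y g sigma2).
  apply: measurable_funD => //; apply: measurable_funD => //.
  exact: measurable_funM.
pose B := [set w | recv_power X Y g sigma2 w \in Interval (BSide true tau) +oo%O].
have mB : measurable B.
  have := mf measurableT _ (measurable_itv (Interval (BSide true tau) +oo%O)).
  by rewrite setTI.
have PB : P B = _ := recv_power_tail P X Y _ _ _ _ tau p0 true m0 g0 lawX lawY XY.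
rewrite /PMD (_ : [set w | _] = ~` B).
  by rewrite probability_setC// PB.
by apply/seteqP; split => w /=; rewrite /B/= in_itv/= andbT ltNge => /negP.
Qed.

End detection_errors.

Theorem theorem2 (R : realType) (sigma2 gamma Pmax lam lamt : R)
  (hsigma : 0 < sigma2) (hgamma : 0 < gamma) (hPmax : 0 < Pmax)
  (hlam : 0 < lam) (hlamlt : lam < lamt)
  (* hypothesis H0 : Pw = X0 + gamma Pj + sigma2 *)
  (d0 : measure_display) (T0 : measurableType d0) (P0 : probability T0 R)
  (X0 Pj0 : {RV P0 >-> R})
  (hX0 : has_law X0 (exponential_prob (lam^-1)))
  (hPj0 : has_law Pj0 (uniform_prob hPmax))
  (hind0 : indep2 P0 X0 Pj0)
  (* hypothesis H1 : Pw = X1 + gamma Pj + sigma2 *)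
  (d1 : measure_display) (T1 : measurableType d1) (P1 : probability T1 R)
  (X1 Pj1 : {RV P1 >-> R})
  (hX1 : has_law X1 (exponential_prob (lamt^-1)))
  (hPj1 : has_law Pj1 (uniform_prob hPmax))
  (hind1 : indep2 P1 X1 Pj1) :
  let Pe := fun tau => PFA P0 X0 Pj0 gamma sigma2 tau
                       + PMD P1 X1 Pj1 gamma sigma2 tau in
  let Delta := (expR (gamma * Pmax / lam) - 1) / (expR (gamma * Pmax / lamt) - 1) in
  let tau_star := lamt * lam / (lamt - lam) * ln Delta + sigma2 in
  sigma2 + gamma * Pmax <= tau_star /\
  (forall tau, 0 < tau -> Pe tau_star <= Pe tau) /\
  Pe tau_star =
    1 - (lamt * (expR (gamma * Pmax / lamt) - 1) * Delta `^ (lam / (lam - lamt))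
         - lam * (expR (gamma * Pmax / lam) - 1) * Delta `^ (lamt / (lam - lamt)))
        / (gamma * Pmax).
Proof.
move=> Pe Delta tau_star.
have hlamt : 0 < lamt by exact: lt_trans hlamlt.
have a0 : 0 < gamma * Pmax by rewrite mulr_gt0.
have PeE tau : Pe tau = 1 - (exp_unif_tail (gamma * Pmax) lamt (tau - sigma2)
                            - exp_unif_tail (gamma * Pmax) lam (tau - sigma2)).
  rewrite /Pe (PFA_exp_unif P0 X0 Pj0 lam gamma Pmax sigma2 hPmax)//.
  rewrite (PMD_exp_unif P1 X1 Pj1 lamt gamma Pmax sigma2 hPmax)//; ring.
(* Subtracting [sigma2] from [tau_star] leaves the maximizer of the gap, so all three claims become
   statements about the gap. *)
rewrite !PeE addrK; split.
  by rewrite addrC lerD2r; exact: optimal_threshold_ge.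
split.
  move=> tau _; rewrite PeE lerD2l lerN2; exact: gap_le_optimal_threshold.
by congr (1 - _); exact: gap_optimal_threshold.
Qed.
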